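(* Let $p=(x+iy,t)\in(\mathbb C\times\mathbb R)\setminus\{(0,0)\}$, set $r=x^2+y^2$ and $D(p)=r^2+t^2$, and define $I(p)=(x'+iy',t')$ by $$x'=\frac{2(-rx+ty)}{D(p)},\qquad y'=\frac{2(-tx-ry)}{D(p)},\qquad t'=\frac{-4t}{D(p)}.$$ Let $\sigma(Z_0,Z_1,Z_2)=(Z_2,Z_1,Z_0)$ on $\mathbb C^3$. Then $\sigma$ preserves the Siegel form $H$, exchanges $\widehat\xi(\infty)$ and $\widehat\xi(0,0)$, and for every $p\neq(0,0)$ $$\widehat\xi(I(p))=\alpha(p)\,\sigma(\widehat\xi(p)),\qquad \alpha(p)=\frac{-2r-2it}{D(p)}.$$ Consequently $I$ is the boundary projective map induced by the linear isometry $\sigma$. Moreover $D(p)=0$ only at the finite origin, and for $p\neq(0,0)$ one has $D(I(p))=16/D(p)$ and $I(I(p))=p$; hence the induced compactified boundary map $I_\partial$ on $(\mathbb C\times\mathbb R)\cup\{\infty\}$, equal to $I$ on finite points $\neq(0,0)$ and exchanging $(0,0)$ and $\infty$, is an involution. Finally, for finite points $p,q,a,b,c,d$ all different from the origin, $$K(I(p),I(q))=\alpha(p)\overline{\alpha(q)}\,K(p,q),$$ $$X(I(a),I(b);I(c),I(d))=X(a,b;c,d),$$ $$T(I(a),I(b),I(c))=|\alpha(a)|^2|\alpha(b)|^2|\alpha(c)|^2\,T(a,b,c),$$ $$X(I_\partial(\infty),I(b);I(c),I(d))=X(\infty,b;c,d),\qquad T(I_\partial(\infty),I(p),I(q))=|\alpha(p)|^2|\alpha(q)|^2\,T(\infty,p,q),$$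 where the cross-ratio identities are asserted whenever the denominators are nonzero.
   Context: The Siegel Hermitian form on $\mathbb C^3$ is $H(Z,W)=Z_0\overline{W_2}+Z_1\overline{W_1}+Z_2\overline{W_0}$. The compactified Heisenberg boundary is $(\mathbb C\times\mathbb R)\cup\{\infty\}$; the lift of a finite point is $\widehat\xi(\zeta,t)=\left(\frac{-|\zeta|^2+it}{2},\zeta,1\right)$ and $\widehat\xi(\infty)=(1,0,0)$; all these lifts are $H$-null. For boundary points (finite or $\infty$): $K(p,q)=H(\widehat\xi(p),\widehat\xi(q))$, $X(a,b;c,d)=\dfrac{K(c,a)K(d,b)}{K(d,a)K(c,b)}$, and $T(a,b,c)=-K(a,b)K(b,c)K(c,a)$. *)

(* Defs.v *)
From mathcomp Require Import all_boot all_order all_algebra.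
From mathcomp Require Import reals.
From mathcomp Require Export complex.

Set Implicit Arguments.
Unset Strict Implicit.
Unset Printing Implicit Defensive.

Import Order.TTheory GRing.Theory Num.Theory.
Local Open Scope ring_scope.
Local Open Scope complex_scope.

Section Heisenberg.
Variable R : realType.
Local Notation C := R[i].

Definition vec3 (a b c : C) : 'rV[C]_3 := \row_(i < 3) [:: a; b; c]`_i.

Definition siegel_form (Z W : 'rV[C]_3) : C :=
  Z 0 0 * (W 0 2)^*%R + Z 0 1 * (W 0 1)^*%R + Z 0 2 * (W 0 0)^*%R.

Definition linear_isometry (L : 'rV[C]_3 -> 'rV[C]_3) : Prop :=
  linear L /\ forall Z W, siegel_form (L Z) (L W) = siegel_form Z W.

Definition heis : Type := (C * R)%type.

Definition origin : heis := (0, 0).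

(* [None] is the point at infinity. *)
Definition boundary : Type := option heis.

Definition xi_hat (p : boundary) : 'rV[C]_3 :=
  match p with
  | Some (zeta, t) => vec3 ((- `|zeta| ^+ 2 + (0 +i* t)) / 2) zeta 1
  | None => vec3 1 0 0
  end.

(* [L] sends the projective class of the lift of [p] to that of [q];
   a point of the projective plane is represented by a line of C^3. *)
Definition projective_image (L : 'rV[C]_3 -> 'rV[C]_3) (p q : boundary) : Prop :=
  <[xi_hat q]>%VS = <[L (xi_hat p)]>%VS.

Definition K (p q : boundary) : C := siegel_form (xi_hat p) (xi_hat q).

Definition X (a b c d : boundary) : C := (K c a * K d b) / (K d a * K c b).

Definition X_denominator (a b c d : boundary) : C := K d a * K c b.

Definition T (a b c : boundary) : C := - (K a b * K b c * K c a).

Definition rsq (p : heis) : R := complex.Re p.1 ^+ 2 + complex.Im p.1 ^+ 2.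

Definition D (p : heis) : R := rsq p ^+ 2 + p.2 ^+ 2.

(* Meaningful only for [p] different from [origin]. *)
Definition inversion (p : heis) : heis :=
  let x := complex.Re p.1 in let y := complex.Im p.1 in
  let t := p.2 in let r := rsq p in
  ((2 * (- (r * x) + t * y) / D p) +i* (2 * (- (t * x) - r * y) / D p),
   - 4 * t / D p).

Definition alpha (p : heis) : C :=
  ((- 2 * rsq p) +i* (- 2 * p.2)) / (D p)%:C.

Definition sigma (Z : 'rV[C]_3) : 'rV[C]_3 := vec3 (Z 0 2) (Z 0 1) (Z 0 0).

Definition boundary_inversion (p : boundary) : boundary :=
  match p with
  | None => Some origin
  | Some p => if (p.1 == 0) && (p.2 == 0) then None else Some (inversion p)
  end.

End Heisenberg.

Arguments origin {R}.

(* Main.v *)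
(** The invariance statements reduce to [xi_hat (I p) = lambda(p) sigma (xi_hat p)] with
    [lambda(p)] nonzero, valid on the whole compactified boundary. A boundary point
    is determined by the line spanned by its lift, so [sigma] being an involution
    makes the boundary map one; since [sigma] is an isometry, [K] changes only by
    [lambda(p) (lambda(q))^*], which cancels in [X] and gives the squared moduli
    in [T]. *)

Require Import Defs.
From mathcomp Require Import all_boot all_order all_algebra.
From mathcomp Require Import reals.
From mathcomp Require Import ring.

Set Implicit Arguments.
Unset Strict Implicit.
Unset Printing Implicit Defensive.

Import Order.TTheory GRing.Theory Num.Theory.
Local Open Scope ring_scope.

Section Inversion.
Context {R : realType}.
Implicit Types (p : heis R) (u v a b c d : boundary R) (Z W : 'rV[R[i]]_3).

Lemma vec3E (a b c : R[i]) :
  (vec3 a b c 0 0 = a) * (vec3 a b c 0 1 = b) * (vec3 a b c 0 2 = c).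
Proof. by rewrite !mxE. Qed.

Lemma row3P Z W :
  Z 0 0 = W 0 0 -> Z 0 1 = W 0 1 -> Z 0 2 = W 0 2 -> Z = W.
Proof.
move=> h0 h1 h2; apply/rowP => -[[|[|[|i]]] hi] //.
- by rewrite (_ : Ordinal hi = 0) //; apply: val_inj.
- by rewrite (_ : Ordinal hi = 1) //; apply: val_inj.
- by rewrite (_ : Ordinal hi = 2) //; apply: val_inj.
Qed.

Lemma linear_sigma : linear (@sigma R).
Proof. by move=> k Z W; apply: row3P; rewrite !(vec3E, mxE). Qed.

Lemma sigmaZ (k : R[i]) Z : sigma (k *: Z) = k *: sigma Z.
Proof. by apply: row3P; rewrite !(vec3E, mxE). Qed.

Lemma sigmaK : involutive (@sigma R).
Proof. by move=> Z; apply: row3P; rewrite !vec3E. Qed.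

Lemma siegel_form_sigma Z W : siegel_form (sigma Z) (sigma W) = siegel_form Z W.
Proof. by rewrite /siegel_form !vec3E; ring. Qed.

Lemma siegel_formZ (k l : R[i]) Z W :
  siegel_form (k *: Z) (l *: W) = k * l^* * siegel_form Z W.
Proof. by rewrite /siegel_form !mxE !rmorphM /=; ring. Qed.

Lemma D_eq0 p : D p = 0 <-> p = origin.
Proof.
case: p => -[x y] t; rewrite /D /rsq /=; split => [/eqP|[-> -> ->]]; last by ring.
rewrite paddr_eq0 ?sqr_ge0 // !sqrf_eq0 paddr_eq0 ?sqr_ge0 // !sqrf_eq0.
by move=> /andP[/andP[/eqP-> /eqP->] /eqP->].
Qed.

Lemma D_neq0 p : p <> origin -> D p != 0.
Proof. by move=> p0; apply/eqP => /D_eq0. Qed.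

(** [D p] is four times the squared modulus of the first coordinate of the lift of [p]. The
    inversion replaces that coordinate by its reciprocal, hence the constant 16. *)
Lemma D_inversion p : p <> origin -> D (inversion p) = 16 / D p.
Proof.
move=> /D_neq0; case: p => -[x y] t; rewrite /inversion /D /rsq /= => D0.
by field.
Qed.

Lemma inversion_neq_origin p : p <> origin -> inversion p <> origin.
Proof.
move=> p0 /D_eq0; rewrite D_inversion // => /eqP.
by rewrite mulf_eq0 invr_eq0 (negPf (D_neq0 p0)) pnatr_eq0.
Qed.

Lemma xi_hat_someE (x y t : R) :
  xi_hat (Some ((x +i* y)%C, t)) =
  vec3 (- (x ^+ 2 + y ^+ 2) / 2 +i* (t / 2))%C (x +i* y)%C 1.
Proof.
rewrite /xi_hat -add_Re2_Im2 /=; congr vec3.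
(* Clearing the complex division by 2 leaves sums and products, whose real and imaginary parts can
   be compared separately. *)
apply: (mulIf (_ : 2 != 0)); first by rewrite pnatr_eq0.
rewrite divfK ?pnatr_eq0 // (_ : 2 = 2%:C%C) ?rmorph_nat //.
by apply/eqP; rewrite eq_complex /=; apply/andP; split; apply/eqP; field.
Qed.

Lemma alphaE p :
  alpha p = ((- 2 * rsq p / D p) +i* (- 2 * p.2 / D p))%C.
Proof.
rewrite /alpha -fmorphV; apply/eqP; rewrite eq_complex /=.
by apply/andP; split; apply/eqP; ring.
Qed.

(** [alpha p] is the inverse of [(-r + it)/2], the first coordinate of the lift. It therefore
    rescales the swapped lift so that its last coordinate is again 1. *)
Lemma xi_hat_inversion p : p <> origin ->
  xi_hat (Some (inversion p)) = alpha p *: sigma (xi_hat (Some p)).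
Proof.
move=> /D_neq0; rewrite alphaE; case: p => -[x y] t.
rewrite /inversion !xi_hat_someE /D /rsq /= => D0.
apply: row3P; rewrite [RHS]mxE !vec3E; apply/eqP; rewrite eq_complex /=;
  by apply/andP; split; apply/eqP; field.
Qed.

(** The last coordinate, 1 at finite points and 0 at infinity, separates the two kinds and forces
    [k = 1] between finite points. The case [k = 0] is covered because no lift vanishes. *)
Lemma xi_hat_proj_inj u v (k : R[i]) : xi_hat u = k *: xi_hat v -> u = v.
Proof.
move=> h; have e i : xi_hat u 0 i = k * xi_hat v 0 i by rewrite h mxE.
move: (e 0) (e 1) (e 2) => {h e}.
case: u v => [[[x y] t]|] [[[x' y'] t']|] //; rewrite ?xi_hat_someE !vec3E.
- move=> + + /esym; rewrite mulr1 => + + k1; rewrite {}k1 !mul1r.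
  (* The imaginary part of the first coordinate gives [t]; the middle coordinate gives the complex
     component. *)
  move=> [_ /(mulIf _) ->]; first by move=> [-> ->].
  by rewrite invr_eq0 pnatr_eq0.
- by move=> _ _ /eqP; rewrite mulr0 oner_eq0.
- by move=> + _; rewrite mulr1 => + /esym k0; rewrite k0 mul0r => /eqP;
    rewrite oner_eq0.
Qed.

Lemma sigma_origin : sigma (xi_hat (Some origin : boundary R)) = xi_hat None.
Proof.
by apply: row3P; rewrite !vec3E // normr0 expr0n /= oppr0 add0r mul0r.
Qed.

Lemma sigma_infty : sigma (xi_hat (None : boundary R)) = xi_hat (Some origin).
Proof. by rewrite -sigma_origin sigmaK. Qed.

Lemma originP p : reflect (p = origin) ((p.1 == 0) && (p.2 == 0)).
Proof.
by case: p => z t; apply: (iffP andP) => [[/eqP/= -> /eqP/= ->]|[-> ->]].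
Qed.

Lemma boundary_inversionE p :
  p <> origin -> boundary_inversion (Some p) = Some (inversion p).
Proof. by rewrite /boundary_inversion; case: originP. Qed.

(** The factor [lambda] on the whole boundary. It is 1 at the origin and at infinity, whose lifts
    [sigma] swaps exactly; [alpha origin] would be the default value 0. *)
Definition scale_factor u : R[i] :=
  if u is Some p then if (p.1 == 0) && (p.2 == 0) then 1 else alpha p else 1.

Lemma scale_factorE p : p <> origin -> scale_factor (Some p) = alpha p.
Proof. by rewrite /scale_factor; case: originP. Qed.

Lemma xi_hat_boundary_inversion u :
  xi_hat (boundary_inversion u) = scale_factor u *: sigma (xi_hat u).
Proof.
case: u => [p|]; last by rewrite scale1r sigma_infty.
rewrite /boundary_inversion /scale_factor.
case: originP => [->|]; last exact: xi_hat_inversion.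
by rewrite scale1r sigma_origin.
Qed.

(** A zero factor would make a lift vanish; by [xi_hat_proj_inj] with [k = 0] its point would then
    equal every boundary point. *)
Lemma scale_factor_neq0 u : scale_factor u != 0.
Proof.
apply/eqP => s0; have := xi_hat_boundary_inversion u; rewrite s0 scale0r => x0.
have e v : boundary_inversion u = v.
  by apply: (@xi_hat_proj_inj _ _ 0); rewrite x0 scale0r.
by have := e None; rewrite (e (Some origin)).
Qed.

Lemma boundary_inversionK : involutive (@boundary_inversion R).
Proof.
move=> u; apply: xi_hat_proj_inj.
by rewrite !xi_hat_boundary_inversion sigmaZ sigmaK scalerA.
Qed.

Lemma inversionK p : p <> origin -> inversion (inversion p) = p.
Proof.
move=> p0; have := boundary_inversionK (Some p).
rewrite !boundary_inversionE //; last exact: inversion_neq_origin.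
by case.
Qed.

Lemma vline_scale (k : R[i]) Z : k != 0 -> <[k *: Z]>%VS = <[Z]>%VS.
Proof.
move=> k0; apply/eqP; rewrite eqEsubv -!memvE memvZ ?memv_line //=.
by apply/vlineP; exists k^-1; rewrite scalerK.
Qed.

Lemma projective_image_sigma u v :
  projective_image (@sigma R) u v <-> v = boundary_inversion u.
Proof.
have s0 := scale_factor_neq0 u.
(* Rescaling by the nonzero factor turns the target line into the one spanned by a lift, so that
   [xi_hat_proj_inj] applies. *)
rewrite /projective_image -[RHS](vline_scale _ s0) -xi_hat_boundary_inversion.
split=> [e|-> //]; have /vlineP[k] : xi_hat v \in <[xi_hat (boundary_inversion u)]>%VS.
  by rewrite -e memv_line.
exact: xi_hat_proj_inj.
Qed.

Lemma K_boundary_inversion u v :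
  K (boundary_inversion u) (boundary_inversion v) =
  scale_factor u * (scale_factor v)^* * K u v.
Proof.
by rewrite /K !xi_hat_boundary_inversion siegel_formZ siegel_form_sigma.
Qed.

(* Both sides are the junk value 0 when a denominator vanishes. *)
Lemma X_boundary_inversion a b c d :
  X (boundary_inversion a) (boundary_inversion b)
    (boundary_inversion c) (boundary_inversion d) = X a b c d.
Proof.
rewrite /X !K_boundary_inversion.
move: (scale_factor_neq0 a) (scale_factor_neq0 b)
  (scale_factor_neq0 c) (scale_factor_neq0 d).
move: (scale_factor a) (scale_factor b) (scale_factor c) (scale_factor d).
move=> ka kb kc kd a0 b0 c0 d0.
(* Each of the four points occurs once, in the same slot of [K], in the numerator and in the
   denominator, so both acquire the same factor [m]. *)
set m := kc * ka^* * (kd * kb^* ).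
have m0 : m != 0 by rewrite !mulf_neq0 ?fmorph_eq0.
have -> : kc * ka^* * K c a * (kd * kb^* * K d b) = m * (K c a * K d b).
  by rewrite /m; ring.
have -> : kd * ka^* * K d a * (kc * kb^* * K c b) = m * (K d a * K c b).
  by rewrite /m; ring.
by rewrite -mulf_div divff // mul1r.
Qed.

(** In the cyclic product each point occurs once in either slot of [K], so its factor meets its own
    conjugate. *)
Lemma T_boundary_inversion a b c :
  T (boundary_inversion a) (boundary_inversion b) (boundary_inversion c) =
  `|scale_factor a| ^+ 2 * `|scale_factor b| ^+ 2 * `|scale_factor c| ^+ 2
    * T a b c.
Proof. by rewrite /T !K_boundary_inversion !normCK; ring. Qed.

End Inversion.

Theorem proposition16p6 (R : realType) :
  linear_isometry (@sigma R) /\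
  sigma (xi_hat (None : boundary R)) = xi_hat (Some origin) /\
  sigma (xi_hat (Some origin : boundary R)) = xi_hat None /\
  (forall p : heis R, p <> origin ->
     xi_hat (Some (inversion p)) = alpha p *: sigma (xi_hat (Some p))) /\
  (forall p : heis R, p <> origin -> forall q : boundary R,
     projective_image (@sigma R) (Some p) q <-> q = Some (inversion p)) /\
  (forall p q : boundary R,
     projective_image (@sigma R) p q <-> q = boundary_inversion p) /\
  (forall p : heis R, D p = 0 <-> p = origin) /\
  (forall p : heis R, p <> origin -> D (inversion p) = 16 / D p) /\
  (forall p : heis R, p <> origin -> inversion (inversion p) = p) /\
  involutive (@boundary_inversion R) /\
  (forall p q : heis R, p <> origin -> q <> origin ->
     K (Some (inversion p)) (Some (inversion q)) =
     alpha p * (alpha q)^* * K (Some p) (Some q)) /\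
  (forall a b c d : heis R,
     a <> origin -> b <> origin -> c <> origin -> d <> origin ->
     X_denominator (Some a) (Some b) (Some c) (Some d) != 0 ->
     X (Some (inversion a)) (Some (inversion b))
       (Some (inversion c)) (Some (inversion d)) =
     X (Some a) (Some b) (Some c) (Some d)) /\
  (forall a b c : heis R, a <> origin -> b <> origin -> c <> origin ->
     T (Some (inversion a)) (Some (inversion b)) (Some (inversion c)) =
     `|alpha a| ^+ 2 * `|alpha b| ^+ 2 * `|alpha c| ^+ 2 *
       T (Some a) (Some b) (Some c)) /\
  (forall b c d : heis R, b <> origin -> c <> origin -> d <> origin ->
     X_denominator None (Some b) (Some c) (Some d) != 0 ->
     X (boundary_inversion None) (Some (inversion b))
       (Some (inversion c)) (Some (inversion d)) =
     X None (Some b) (Some c) (Some d)) /\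
  (forall p q : heis R, p <> origin -> q <> origin ->
     T (boundary_inversion None) (Some (inversion p)) (Some (inversion q)) =
     `|alpha p| ^+ 2 * `|alpha q| ^+ 2 * T None (Some p) (Some q)).
Proof.
split; first by split; [exact: linear_sigma|exact: siegel_form_sigma].
split; first exact: sigma_infty.
split; first exact: sigma_origin.
split; first exact: xi_hat_inversion.
split=> [p p0 q|].
  (* Away from the origin, [inversion] folds back into [boundary_inversion], making the finite
     statement an instance of the one on the whole boundary. *)
  by rewrite -boundary_inversionE //; exact: projective_image_sigma.
split; first exact: projective_image_sigma.
split; first exact: D_eq0.
split; first exact: D_inversion.
split; first exact: inversionK.
split; first exact: boundary_inversionK.
split=> [p q p0 q0|].
  by rewrite -!boundary_inversionE // K_boundary_inversion !scale_factorE.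
split=> [a b c d a0 b0 c0 d0 _|].
  by rewrite -!boundary_inversionE // X_boundary_inversion.
split=> [a b c a0 b0 c0|].
  by rewrite -!boundary_inversionE // T_boundary_inversion !scale_factorE.
split=> [b c d b0 c0 d0 _|p q p0 q0].
  by rewrite -!boundary_inversionE // X_boundary_inversion.
rewrite -!boundary_inversionE // T_boundary_inversion !scale_factorE //.
(* The scale factor at infinity is 1. *)
by rewrite normr1 expr1n mul1r.
Qed.
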